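(* Let $D$ be the digraph with vertices $\{0,1,2,3,4\}$ and the nine arrows \[ 0\to1,\ 1\to2,\ 2\to0,\quad 0\to3,\ 1\to3,\ 2\to3,\quad 0\to4,\ 1\to4,\ 2\to4 . \] For an arrow signing $\sigma:A(D)\to\{+1,-1\}$ write $\beta_p^\sigma=\dim_{\mathbb R}H_p^\sigma(D)$. Among the $2^9=512$ arrow signings of $D$, the vector $(\beta_0^\sigma,\beta_1^\sigma,\beta_2^\sigma)$ takes exactly the following four values: \begin{itemize} \item $(1,0,1)$ for $16$ signings, one representative having no negative arrows; \item $(0,0,0)$ for $240$ signings, one representative having set of negative arrows $\{2\to4\}$; \item $(0,2,0)$ for $240$ signings, one representative having set of negative arrows $\{2\to3,\,2\to4\}$; \item $(0,4,0)$ for $16$ signings, one representative having set of negative arrows $\{2\to0,\,1\to3,\,1\to4\}$. \end{itemize} For every signing, $H_p^\sigma(D)=0$ for all $p\ge3$. Moreover, $H_2^\sigma(D)$ is one-dimensional precisely when $(D,\sigma)$ is switching-balanced, and vanishes for every other signing.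
   Context: Signed digraphs. A signed digraph is a pair $(D,\sigma)$ where $D=(V,A)$ is a finite loopless digraph with at most one arrow from $i$ to $j$ for each ordered pair $(i,j)$, and $\sigma:A\to\{+1,-1\}$. It is switching-balanced if there is $\eta:V\to\{+1,-1\}$ with $\sigma(ij)=\eta(i)\eta(j)$ for every arrow $i\to j$. The signed double cover $\widetilde D_\sigma$ is the digraph with vertices $i^\varepsilon=(i,\varepsilon)\in V\times\{+1,-1\}$ and arrows $i^\varepsilon\to j^{\varepsilon\sigma(ij)}$ for each arrow $i\to j$ of $D$ and each $\varepsilon$; the deck involution is $\tau(i^\varepsilon)=i^{-\varepsilon}$, acting on paths vertexwise. Signed GLMY homology (over $\mathbb R$). A $p$-path on $V\times\{+1,-1\}$ is a sequence of $p+1$ lifted vertices; it is regular if consecutive lifted vertices are distinct (so $u^+u^-$ is regular, $u^+u^+$ is not) and allowed if consecutive lifted vertices are joined by arrows of $\widetilde D_\sigma$. $\mathcal R_p(\widetilde D_\sigma)$ is the real vector space with basis $e_{\widetilde\gamma}$, $\widetilde\gamma$ a regular $p$-path (no arrow condition), with boundary $e_{v_0\cdots v_p}\mapsto\sum_{q=0}^p(-1)^qe_{v_0\cdots\widehat{v_q}\cdots v_p}$ for $p\ge1$ (nonregular terms are zero), and zero boundary for $p=0$. $R_p^\sigma(D)$ is the quotient of $\mathcal R_p(\widetilde D_\sigma)$ by the span of all $e_{\tau\widetilde\gamma}+e_{\widetilde\gamma}$; the boundary induces $\partial^\sigma_{\mathrm{reg},p}:R_p^\sigma(D)\to R_{p-1}^\sigma(D)$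 (zero for $p=0$). $\mathcal A_p^\sigma(D)\subseteq R_p^\sigma(D)$ is the span of the classes of allowed paths. Set $\Omega_0^\sigma(D)=\mathcal A_0^\sigma(D)$, $\Omega_p^\sigma(D)=\{z\in\mathcal A_p^\sigma(D):\partial^\sigma_{\mathrm{reg},p}z\in\mathcal A^\sigma_{p-1}(D)\}$ for $p\ge1$, $\Omega_{-1}^\sigma(D)=0$, with boundary $\partial_p^\sigma$ the restriction of $\partial^\sigma_{\mathrm{reg},p}$. $H_p^\sigma(D)$ is the homology of $(\Omega_\bullet^\sigma(D),\partial_*^\sigma)$. *)

(* Defs.v *)
From HB Require Import structures.
From mathcomp Require Import all_boot all_order all_algebra.
From mathcomp Require Import reals.

Set Implicit Arguments.
Unset Strict Implicit.
Unset Printing Implicit Defensive.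

Import GRing.Theory.
Local Open Scope ring_scope.

Section QuotientSpace.
Variables (K : fieldType) (vT : vectType K) (U : {vspace vT}).
Local Open Scope quotient_scope.

(* The carrier is the library's quotient of an additive group by a subgroup;  *)
(* only the scaling and the finite dimension have to be added.                *)
Definition quotv : Type := Quotient.quot (U : zmodClosed vT).
HB.instance Definition _ := GRing.Zmodule.on quotv.
HB.instance Definition _ := EqQuotient.on quotv.

Let pi (x : vT) : quotv := \pi_quotv x.

Fact quotv_eqE x y : (pi x == pi y) = (x - y \in U).
Proof. exact: (esym (Quotient.idealrBE (U : zmodClosed vT) x y)). Qed.

Fact quotv_piD x y : pi (x + y) = pi x + pi y.
Proof. exact: (raddfD (\pi_(Quotient.quot (U : zmodClosed vT)))). Qed.

Fact quotv_piK x : pi (repr x) = x.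
Proof. exact: reprK. Qed.

Fact quotv_repr x : repr (pi x) - x \in U.
Proof. by rewrite -quotv_eqE /pi reprK. Qed.

Definition quotv_scale (a : K) (x : quotv) : quotv := pi (a *: repr x).

Fact quotv_piZ a x : pi (a *: x) = quotv_scale a (pi x).
Proof.
apply/esym/eqP; rewrite /quotv_scale quotv_eqE -scalerBr. apply: memvZ. exact: quotv_repr.
Qed.

Fact quotv_scaleA a b x :
  quotv_scale a (quotv_scale b x) = quotv_scale (a * b) x.
Proof. by rewrite -[x]quotv_piK -!quotv_piZ scalerA. Qed.
Fact quotv_scale1 : left_id 1 quotv_scale.
Proof. by move=> x; rewrite -[x]quotv_piK -quotv_piZ scale1r. Qed.
Fact quotv_scaleDr : right_distributive quotv_scale +%R.
Proof.
move=> a x y; rewrite -[x]quotv_piK -[y]quotv_piK.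
by rewrite -quotv_piD -!quotv_piZ scalerDr quotv_piD.
Qed.
Fact quotv_scaleDl x : {morph quotv_scale^~ x : a b / a + b}.
Proof.
by move=> a b; rewrite -[x]quotv_piK -!quotv_piZ scalerDl quotv_piD.
Qed.

HB.instance Definition _ := GRing.Zmodule_isLmodule.Build K quotv
  quotv_scaleA quotv_scale1 quotv_scaleDr quotv_scaleDl.

Fact quotv_pi_linear : linear pi.
Proof. by move=> a x y; rewrite quotv_piD quotv_piZ. Qed.
HB.instance Definition _ :=
  GRing.isLinear.Build K vT quotv _ pi quotv_pi_linear.

Fact quotv_vect_axiom : Vector.axiom (\dim (U^C)%VS) quotv.
Proof.
pose C := subvs_of (U^C)%VS.
pose g (x : vT) : C := vsproj (U^C)%VS (x - projv U x).
have gC x : val (g x) = x - projv U x by rewrite /= vsprojK ?memv_projC.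
have gl : linear g.
  move=> a x y; apply: val_inj; rewrite gC [RHS]linearP /=.
  by rewrite -![vsval _]/(val _) !gC linearP scalerBr opprD addrACA.
have gU x : x \in U -> g x = 0.
  by move=> Ux; apply: val_inj; rewrite gC projv_id ?subrr.
have gB x y : g (x - y) = g x - g y.
  by rewrite addrC -scaleN1r gl scaleN1r addrC.
pose f (x : quotv) : C := g (repr x).
have fpi x : f (pi x) = g x.
  by apply/eqP; rewrite -subr_eq0 -gB gU ?quotv_repr.
have fl : linear f.
  move=> a x y; rewrite -[x]quotv_piK -[y]quotv_piK.
  by rewrite -(linearP pi) !fpi gl.
have [h hl hbij] : Vector.axiom (\dim (U^C)%VS) C := subvs_vect_iso _.
exists (h \o f) => [a x y|]; first by rewrite /= fl hl.
have [h' hK h'K] := hbij; exists (fun r => pi (val (h' r))) => [x|r] /=.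
  rewrite hK /f gC -[RHS]quotv_piK; apply/eqP; rewrite quotv_eqE.
  by rewrite addrAC subrr sub0r memvN memv_proj.
rewrite fpi -[RHS]h'K; congr h; apply: val_inj; rewrite gC.
suff -> : projv U (val (h' r)) = 0 by rewrite subr0.
apply/eqP; rewrite -memv_ker lker_proj; exact: subvsP.
Qed.

HB.instance Definition _ := Lmodule_hasFinDim.Build K quotv quotv_vect_axiom.

Definition qproj : 'Hom(vT, quotv) := linfun pi.

Lemma qprojE x : qproj x = \pi_quotv x.
Proof. exact: (lfunE pi). Qed.

Lemma limg_qproj : limg qproj = fullv.
Proof.
apply/eqP; rewrite eqEsubv subvf /=; apply/subvP => y _.
by rewrite -[y]quotv_piK -[pi _]qprojE memv_img ?memvf.
Qed.

Lemma lker_qproj : lker qproj = U.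
Proof.
apply/vspaceP => x; rewrite memv_ker qprojE.
by rewrite -[0](linear0 pi) quotv_eqE subr0.
Qed.

End QuotientSpace.

(* The map induced on quotients by f: the inverse only picks preimages, and   *)
(* qmapE shows that the choice is irrelevant when f maps U into W.            *)
Definition qmap (K : fieldType) (vT wT : vectType K) (U : {vspace vT})
    (W : {vspace wT}) (f : 'Hom(vT, wT)) : 'Hom(quotv U, quotv W) :=
  (qproj W \o f \o (qproj U)^-1)%VF.

Lemma qmapE (K : fieldType) (vT wT : vectType K) (U : {vspace vT})
    (W : {vspace wT}) (f : 'Hom(vT, wT)) x :
  (f @: U <= W)%VS -> qmap U W f (qproj U x) = qproj W (f x).
Proof.
move=> fUW; rewrite !comp_lfunE /=; apply/eqP; rewrite -subr_eq0 -!linearB.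
rewrite -memv_ker lker_qproj (subvP fUW) // memv_img //.
suff: (qproj U)^-1%VF (qproj U x) - x \in lker (qproj U) by rewrite lker_qproj.
rewrite memv_ker linearB /= subr_eq0.
by rewrite limg_lfunVK // limg_qproj memvf.
Qed.

Record digraph := Digraph {
  vertex :> finType;
  arc : rel vertex;
  arc_irr : irreflexive arc }.

Definition arrow (D : digraph) : finType := {a : D * D | arc a.1 a.2}.

(* The boolean b encodes the sign (-1)^b: true is -1, and (+) (exclusive or)  *)
(* is multiplication of signs.                                                *)
Definition signing (D : digraph) : finType := {ffun arrow D -> bool}.

Definition switching_balanced (D : digraph) (s : signing D) : Prop :=
  exists eta : D -> bool,
    forall a : arrow D, s a = eta (val a).1 (+) eta (val a).2.

Definition lifted (D : digraph) : finType := (D * bool)%type.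

Definition cover_arc (D : digraph) (s : signing D) : rel (lifted D) :=
  fun u v => [exists a : arrow D,
    (val a == (u.1, v.1)) && (v.2 == u.2 (+) s a)].

Definition deck (D : digraph) (u : lifted D) : lifted D := (u.1, ~~ u.2).

Section SignedGLMY.
Variables (R : realType) (D : digraph).

Definition path_ p := p.+1.-tuple (lifted D).

Definition regular p (t : path_ p) : bool := sorted (fun u v => u != v) t.

Definition reg_path p := {t : path_ p | regular t}.

Definition reg_chain p : vectType R := {ffun reg_path p -> R^o}.

(* The basis vector of a regular path; it is 0 on a nonregular path. *)
Definition pbasis p (t : path_ p) : reg_chain p :=
  [ffun g : reg_path p => (val g == t)%:R].

Definition face p (q : 'I_p.+2) (t : path_ p.+1) : path_ p :=
  [tuple tnth t (lift q i) | i < p.+1].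

Definition reg_bd_fun p (c : reg_chain p.+1) : reg_chain p :=
  \sum_(g : reg_path p.+1)
    c g *: \sum_(q < p.+2) (-1) ^+ q *: pbasis (face q (val g)).

Fact reg_bd_linear p : linear (@reg_bd_fun p).
Proof.
move=> a x y; rewrite /reg_bd_fun scaler_sumr -big_split /=.
by apply: eq_bigr => g _; rewrite !ffunE scalerDl scalerA.
Qed.
HB.instance Definition _ p :=
  GRing.isLinear.Build R (reg_chain p.+1) (reg_chain p) _ (@reg_bd_fun p)
    (@reg_bd_linear p).

Definition reg_bd p : 'Hom(reg_chain p.+1, reg_chain p) := linfun (@reg_bd_fun p).

Definition deck_path p (t : path_ p) : path_ p := map_tuple (@deck D) t.

Definition anti p : {vspace reg_chain p} :=
  <<[seq (pbasis (deck_path (val g)) + pbasis (val g))%R | g : reg_path p]>>%VS.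

(* This space depends on D only; the signing enters through allowed paths. *)
Definition signed_chain p : vectType R := quotv (anti p).

Definition cl p (t : path_ p) : signed_chain p := qproj (anti p) (pbasis t).

Definition signed_bd p : 'Hom(signed_chain p.+1, signed_chain p) :=
  qmap (anti p.+1) (anti p) (reg_bd p).

Lemma deckK : involutive (@deck D).
Proof. by case=> v b; rewrite /deck /= negbK. Qed.

Lemma regular_deck p (t : path_ p) : regular (deck_path t) = regular t.
Proof.
rewrite /regular /= sorted_map; apply: eq_sorted => u v /=.
by rewrite (inj_eq (can_inj deckK)).
Qed.

Lemma e_nonregular p (t : path_ p) : ~~ regular t -> pbasis t = 0.
Proof.
move=> Nt; apply/ffunP => g; rewrite !ffunE; case: eqP => // gt.
by rewrite -gt (valP g) in Nt.
Qed.

Lemma face_deck p (q : 'I_p.+2) (t : path_ p.+1) :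
  face q (deck_path t) = deck_path (face q t).
Proof. by apply: eq_from_tnth => i; rewrite !tnth_map. Qed.

Lemma reg_bd_e p (t : path_ p.+1) : regular t ->
  reg_bd p (pbasis t) = \sum_(q < p.+2) (-1) ^+ q *: pbasis (face q t).
Proof.
move=> rt; rewrite lfunE /= /reg_bd_fun (bigD1 (Sub t rt)) //=.
rewrite ffunE SubK eqxx scale1r [X in _ + X]big1 ?addr0 // => g gt.
rewrite ffunE; case: eqP => [gt'|_]; last by rewrite scale0r.
by case/eqP: gt; apply: val_inj.
Qed.

Lemma anti_e p (t : path_ p) : pbasis (deck_path t) + pbasis t \in anti p.
Proof.
have [rt|Nt] := boolP (regular t).
  by apply: memv_span; apply/imageP; exists (Sub t rt); rewrite ?SubK.
by rewrite !e_nonregular ?regular_deck // addr0 mem0v.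
Qed.

Lemma reg_bd_anti p : (reg_bd p @: anti p.+1 <= anti p)%VS.
Proof.
rewrite limg_span; apply/span_subvP => _ /mapP[_ /imageP[g _ ->] ->].
rewrite linearD /= !reg_bd_e ?regular_deck ?(valP g) // -big_split /=.
apply: memv_suml => q _; rewrite face_deck -scalerDr memvZ //.
exact: anti_e.
Qed.

Lemma signed_bdE p (c : reg_chain p.+1) :
  signed_bd p (qproj (anti p.+1) c) = qproj (anti p) (reg_bd p c).
Proof. exact/qmapE/reg_bd_anti. Qed.

Variable s : signing D.

Definition allowed p (t : path_ p) : bool := sorted (cover_arc s) t.

Definition allowed_chain p : {vspace signed_chain p} :=
  <<[seq cl t | t in @allowed p]>>%VS.

Definition Omega p : {vspace signed_chain p} :=
  match p with
  | 0 => allowed_chain 0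
  | p'.+1 =>
    (allowed_chain p'.+1 :&: signed_bd p' @^-1: allowed_chain p')%VS
  end.

Definition cycles p : {vspace signed_chain p} :=
  match p with
  | 0 => Omega 0
  | p'.+1 => (Omega p'.+1 :&: lker (signed_bd p'))%VS
  end.

Definition boundaries p : {vspace signed_chain p} :=
  (signed_bd p @: Omega p.+1)%VS.

(* Cycles modulo boundaries, seen inside the quotient of all signed chains    *)
(* by the boundaries.                                                         *)
Definition homology p : {vspace quotv (boundaries p)} :=
  (qproj (boundaries p) @: cycles p)%VS.

Definition betti p : nat := \dim (homology p).

End SignedGLMY.

Definition arcs9 : seq (nat * nat) :=
  [:: (0, 1); (1, 2); (2, 0); (0, 3); (1, 3); (2, 3); (0, 4); (1, 4); (2, 4)]%N.

Definition arc9 : rel 'I_5 :=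
  fun i j => (nat_of_ord i, nat_of_ord j) \in arcs9.

Fact arc9_irr : irreflexive arc9.
Proof. by case; do 5?[case=> //]. Qed.

Definition D9 : digraph := Digraph arc9_irr.

(* The signing of D9 whose negative arrows are those listed in N. *)
Definition neg_on (N : seq (nat * nat)) : signing D9 :=
  [ffun a : arrow D9 =>
    let: (i, j) := (val a : 'I_5 * 'I_5) in
    (nat_of_ord i, nat_of_ord j) \in N].

Definition betti3 (R : realType) (s : signing D9) : nat * nat * nat :=
  (betti R s 0, betti R s 1, betti R s 2).

(* Main.v *)
Require Import Defs.
From HB Require Import structures.
From mathcomp Require Import all_boot all_order all_algebra.
From mathcomp Require Import reals zify.

(* Reading off coordinates along lifted paths, odd under the deck involution, *)
(* shows that a chain of Omega_p (p >= 2) has no coefficient on an allowed    *)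
(* path whose face 1 is not allowed: each vertex has at most one non-sink     *)
(* successor, so no other allowed path can cancel that face. Hence            *)
(* Omega_p = 0 for p >= 3, and Omega_2 is spanned by the t balanced triangles *)
(* among the six transitive ones. The rank of the signed incidence map is     *)
(* 5 - b, with b = 1 if the signing is switching-balanced and 0 otherwise. A  *)
(* 2-cycle has equal coefficients up to sign on all six triangles, so that    *)
(* dim Z_2 = [t = 6], and t = 6 iff b = 1. Therefore the Betti numbers are    *)
(* (b, 4 + 2b - t, b). Since the three triangles at each sink have signs      *)
(* whose product is that of the directed cycle, t is even.                    *)

Set Implicit Arguments.
Unset Strict Implicit.
Unset Printing Implicit Defensive.
Import GRing.Theory Num.Theory.

Local Open Scope ring_scope.
Local Notation arc := Defs.arc.

(** Everything is governed by one integer, the number t = [balanced_count] of balanced transitive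
    triangles. The complex has dimensions 5, 9, t in degrees 0, 1, 2 and vanishes above
    ([dim_allowed0], [Omega1E] with [dim_allowed1], [dim_Omega9_2], [Omega9_eq0]), so only the ranks
    of two boundary maps remain.

    Into degree 0: a spanning tree identifies every vertex class, up to sign and modulo boundaries,
    with the class of the root; the root class is itself a boundary exactly when some arrow violates
    the switching function of the tree ([dim_boundaries9_0]).

    Out of degree 2: the vanishing of the boundary of a 2-cycle ties its six coefficients together,
    so one unbalanced triangle, whose coefficient is 0, kills every 2-cycle. For t = 6 the two fans
    glue to a signed version of the suspension of the directed 3-cycle, a sphere, which spans the
    2-cycles ([dim_cycles9_2]).

    Rank-nullity then gives [betti3_count], and the signings with a given t are counted over the 512
    sign sequences ([card_balanced_count]). *)

Lemma dim_qproj (K : fieldType) (vT : vectType K) (U V : {vspace vT}) :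
  (U <= V)%VS -> (\dim (qproj U @: V) + \dim U = \dim V)%N.
Proof.
by move=> UV; rewrite addnC -(limg_ker_dim (qproj U) V) lker_qproj (capv_idPr UV).
Qed.

Lemma sum_pred1_seq (K : pzRingType) (T : eqType) (X : seq T) (f : T -> K) u :
  uniq X ->
  \sum_(t <- X) f t * (t == u)%:R = if u \in X then f u else 0.
Proof.
move=> uX; case: ifP => [uinX|uX'].
  rewrite (bigD1_seq u) //= eqxx mulr1 big1 ?addr0 // => t /negbTE->.
  by rewrite mulr0.
rewrite big_seq big1 // => t tX; case: eqP => [E|_]; last by rewrite mulr0.
by rewrite -E tX in uX'.
Qed.

(** * Coordinates on signed chains *)

Section SignedChains.
Variables (R : realType) (D : digraph).

Local Notation path_ := (path_ D).
Local Notation cl := (@cl R D _).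
Local Notation chain := (signed_chain R D).

Lemma deck_pathK p : involutive (@deck_path D p).
Proof. by move=> t; apply: val_inj => /=; rewrite mapK //; exact: deckK. Qed.

Lemma deck_path_eq p (t u : path_ p) : (deck_path t == u) = (t == deck_path u).
Proof. by rewrite -(inj_eq (inv_inj (@deck_pathK p))) deck_pathK. Qed.

Lemma deck_path_neq p (t : path_ p) : (t == deck_path t) = false.
Proof.
apply/eqP => /(congr1 (fun u => tnth u ord0)).
by rewrite tnth_map; case: (tnth t ord0) => v [] [].
Qed.

Lemma val_face p (q : 'I_p.+2) (t : path_ p.+1) :
  val (face q t) = take q t ++ drop q.+1 t.
Proof.
have st := size_tuple t; have lq := ltn_ord q.
set x0 := tnth t ord0.
apply: (@eq_from_nth _ x0) => [|i].
  rewrite size_tuple size_cat size_take size_drop st lq subSS subnKC //.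
rewrite size_tuple => ip.
rewrite -[i]/(nat_of_ord (Ordinal ip)) -tnth_nth tnth_mktuple (tnth_nth x0).
rewrite nth_cat size_take st lq /= /bump; case: (leqP q i) => qi /=.
  by rewrite nth_drop [(q.+1 + _)%N]addSn subnKC.
by rewrite nth_take.
Qed.

Lemma cl_deck p (t : path_ p) : cl (deck_path t) = - cl t.
Proof.
apply/eqP; rewrite -addr_eq0 -linearD -memv_ker lker_qproj; exact: anti_e.
Qed.

Lemma signed_bd_cl p (t : path_ p.+1) : regular t ->
  signed_bd R D p (cl t) = \sum_(q < p.+2) (-1) ^+ q *: cl (face q t).
Proof.
move=> rt; rewrite /Defs.cl signed_bdE reg_bd_e // linear_sum /=.
by apply: eq_bigr => q _; rewrite linearZ.
Qed.

Lemma signed_chain_ind p (P : chain p -> Prop) : P 0 ->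
  (forall a x y, P x -> P y -> P (a *: x + y)) ->
  (forall t, regular t -> P (cl t)) -> forall z, P z.
Proof.
move=> P0 PD Pcl z.
have /memv_imgP[c _ ->] : z \in limg (qproj (anti R D p)).
  by rewrite limg_qproj memvf.
have -> : c = \sum_g c g *: pbasis R (val g).
  apply/ffunP => g; rewrite sum_ffunE (bigD1 g) //= !ffunE eqxx big1.
    by rewrite addr0 /GRing.scale /= mulr1.
  move=> h hg; rewrite !ffunE (inj_eq val_inj) eq_sym (negbTE hg).
  by rewrite /GRing.scale /= mulr0.
rewrite linear_sum /=; elim/big_ind: _ => // [x y Px Py|g _].
  by rewrite -[x]scale1r; apply: PD.
rewrite linearZ /= -[X in P X]addr0; apply: PD => //; apply: Pcl; exact: valP.
Qed.

(** Antisymmetrizing the coefficient under the deck involution makes it vanish on the generators of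
    [anti], so it descends to signed chains as [coef]. *)
Definition odd_coef p (t : path_ p) (c : reg_chain R D p) : R^o :=
  \sum_(g : reg_path D p)
    c g * ((val g == t)%:R - (val g == deck_path t)%:R).

Fact odd_coef_linear p (t : path_ p) : linear (odd_coef t).
Proof.
move=> a x y; rewrite /odd_coef scaler_sumr -big_split /=.
by apply: eq_bigr => g _; rewrite !ffunE mulrDl -mulrA.
Qed.
HB.instance Definition _ p (t : path_ p) :=
  GRing.isLinear.Build R (reg_chain R D p) R^o _ (odd_coef t)
    (@odd_coef_linear p t).

Lemma odd_coef_pbasis p (t u : path_ p) : regular u ->
  odd_coef t (pbasis R u) = (u == t)%:R - (u == deck_path t)%:R.
Proof.
move=> ru; rewrite /odd_coef (bigD1 (Sub u ru)) //= ffunE SubK eqxx mul1r.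
rewrite big1 ?addr0 // => g; rewrite -(inj_eq val_inj) SubK ffunE.
by move=> /negbTE->; rewrite mul0r.
Qed.

Definition coef p (t : path_ p) : 'Hom(chain p, R^o) :=
  (linfun (odd_coef t) \o (qproj (anti R D p))^-1)%VF.

Lemma coef_qproj p (t : path_ p) c :
  coef t (qproj (anti R D p) c) = odd_coef t c.
Proof.
rewrite comp_lfunE /= lfunE /=; apply/eqP; rewrite -subr_eq0 -linearB /=.
set d := _ - c; have : d \in anti R D p.
  rewrite -[anti R D p]lker_qproj memv_ker linearB /= subr_eq0.
  by rewrite limg_lfunVK // limg_qproj memvf.
suff /subvP H : (anti R D p <= lker (linfun (odd_coef t)))%VS.
  by move=> /H; rewrite memv_ker lfunE.
apply/span_subvP => _ /imageP[g _ ->]; rewrite memv_ker lfunE linearD /=.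
rewrite !odd_coef_pbasis ?regular_deck ?(valP g) // !deck_path_eq deck_pathK.
by rewrite addrC addrA subrK subrr.
Qed.

Lemma coef_cl p (t u : path_ p) : regular u ->
  coef t (cl u) = (u == t)%:R - (u == deck_path t)%:R.
Proof. by move=> ru; rewrite coef_qproj odd_coef_pbasis. Qed.

Lemma coef_cl_self p (t : path_ p) : regular t -> coef t (cl t) = 1.
Proof. by move=> rt; rewrite coef_cl // eqxx deck_path_neq subr0. Qed.

Lemma coef_deck p (t : path_ p) z : coef (deck_path t) z = - coef t z.
Proof.
elim/signed_chain_ind: z => [|a x y IHx IHy|u ru].
- by rewrite !linear0.
- by rewrite !linearP /= IHx IHy.
by rewrite !coef_cl // deck_pathK opprB.
Qed.

(** Both [coef t z] and [cl t] change sign when [t] is replaced by its deck image, so each term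
    occurs twice in the sum; hence the factor one half. *)
Lemma chain_expand p (z : chain p) :
  z = 2^-1 *: \sum_(t : path_ p) coef t z *: cl t.
Proof.
elim/signed_chain_ind: z => [|a x y IHx IHy|u ru].
- by rewrite big1 ?scaler0 // => t _; rewrite linear0 scale0r.
- rewrite {1}IHx {1}IHy scalerA mulrC -scalerA -scalerDr; congr (_ *: _).
  rewrite scaler_sumr -big_split /=; apply: eq_bigr => t _.
  by rewrite linearP scalerDl; congr (_ + _); exact: scalerA.
have -> : \sum_t coef t (cl u) *: cl t = cl u - cl (deck_path u).
  under eq_bigr => t _ do rewrite coef_cl // scalerBl.
  rewrite sumrB; congr (_ - _).
    rewrite (bigD1 u) //= eqxx scale1r big1 ?addr0 // => t.
    by rewrite eq_sym => /negbTE->; rewrite scale0r.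
  rewrite (bigD1 (deck_path u)) //= deck_pathK eqxx scale1r big1 ?addr0 // => t.
  by rewrite -deck_path_eq eq_sym => /negbTE->; rewrite scale0r.
have two0 : 2%:R != 0 :> R by rewrite pnatr_eq0.
by rewrite cl_deck opprK -[cl u + cl u]mulr2n -(scaler_nat 2 (cl u)) scalerA mulVf ?scale1r.
Qed.

Lemma coef_inj p (x y : chain p) : (forall t, coef t x = coef t y) -> x = y.
Proof.
move=> E; rewrite [x]chain_expand [y]chain_expand.
by congr (_ *: _); apply: eq_bigr => t _; rewrite E.
Qed.

(** The indicator of [t] alone suffices on the right, without subtracting that of its deck image:
    the sum runs over both [u] and its deck image, whose coefficients are opposite, and this
    performs the antisymmetrization. *)
Lemma coef_bd p (t : path_ p) (z : chain p.+1) : regular t ->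
  coef t (signed_bd R D p z) =
    \sum_u coef u z * \sum_(q < p.+2) (-1) ^+ q * (face q u == t)%:R.
Proof.
move=> rt; pose F u := \sum_(q < p.+2) (-1) ^+ q * (face q u == t)%:R : R.
elim/signed_chain_ind: z => [|a x y IHx IHy|w rw].
- by rewrite !linear0 big1 // => u _; rewrite linear0 mul0r.
- rewrite !linearP /= IHx IHy scaler_sumr -big_split /=.
  by apply: eq_bigr => u _; rewrite linearP mulrDl -mulrA.
transitivity (F w - F (deck_path w)).
  rewrite signed_bd_cl // linear_sum -sumrB; apply: eq_bigr => q _ /=.
  rewrite linearZ /= -mulrBr face_deck deck_path_eq; congr (_ * _).
  have [rf|Nf] := boolP (regular (face q w)); first exact: coef_cl.
  rewrite /Defs.cl e_nonregular // !linear0.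
  case: eqP => [E|_]; first by rewrite E rt in Nf.
  case: eqP => [E|_]; last by rewrite subr0.
  by rewrite E regular_deck rt in Nf.
under [RHS]eq_bigr => u _ do
  rewrite coef_cl // mulrBl -deck_path_eq !(eq_sym _ u) !(mulrC _%:R) -/(F u).
rewrite sumrB; congr (_ - _); symmetry.
  by rewrite sum_pred1_seq ?index_enum_uniq ?mem_index_enum.
by rewrite sum_pred1_seq ?index_enum_uniq ?mem_index_enum.
Qed.

Lemma span_clP p (P : pred (path_ p)) (z : chain p) :
    {subset P <= @regular D p} -> (forall t, P (deck_path t) = P t) ->
  z \in <<[seq cl t | t in P]>>%VS <-> (forall t, ~~ P t -> coef t z = 0).
Proof.
move=> Pr PD; split=> [Pz t Nt|Cz].
  apply/eqP; rewrite -memv_ker; move: z Pz; apply/subvP/span_subvP.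
  move=> _ /imageP[u Pu ->]; rewrite memv_ker coef_cl; last exact: Pr.
  case: (u =P t) => [E|_]; first by rewrite -E in Nt; case/negP: Nt.
  case: (u =P deck_path t) => [E|_]; last by rewrite subr0.
  by rewrite -PD -E in Nt; case/negP: Nt.
rewrite [z]chain_expand; apply: memvZ; apply: memv_suml => t _.
have [Pt|Nt] := boolP (P t); last by rewrite Cz // scale0r mem0v.
by apply/memvZ/memv_span/imageP; exists t.
Qed.

(** At most one representative of each deck pair is kept, so that the classes become linearly
    independent ([free_cl]): each [coef t] is dual to [cl t]. *)
Definition deck_free p (X : seq (path_ p)) :=
  [/\ uniq X, {subset X <= @regular D p} &
      forall t, t \in X -> deck_path t \notin X].

Lemma deck_free_expand p (X : seq (path_ p)) (z : chain p) :
    deck_free X ->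
    (forall t, t \notin X -> deck_path t \notin X -> coef t z = 0) ->
  z = \sum_(t <- X) coef t z *: cl t.
Proof.
case=> uX rX NX Cz; apply: coef_inj => u; rewrite linear_sum /=.
have -> : \sum_(t <- X) coef u (coef t z *: cl t) =
    \sum_(t <- X) coef t z * (t == u)%:R -
    \sum_(t <- X) coef t z * (t == deck_path u)%:R.
  rewrite -sumrB big_seq [RHS]big_seq; apply: eq_bigr => t tX.
  rewrite linearZ /= -mulrBr coef_cl //; exact: rX.
rewrite !sum_pred1_seq //; case: ifPn => [/NX/negbTE->|uNX].
  by rewrite subr0.
case: ifPn => [_|dNX]; first by rewrite coef_deck sub0r opprK.
by rewrite Cz ?subrr.
Qed.

Lemma free_cl p (X : seq (path_ p)) :
  deck_free X -> free [seq cl t | t <- X].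
Proof.
elim: X => [|t X IH] [/= uX rX NX]; first exact: nil_free.
case/andP: uX => tX uX.
have rt : regular t by apply: rX; rewrite mem_head.
have sX u : u \in X -> u \in t :: X by rewrite inE orbC => ->.
rewrite free_cons IH ?andbT; last first.
  split=> // [u /sX/rX //|u /sX/NX]; by rewrite inE negb_or => /andP[].
have dtX : deck_path t \notin X.
  by have := NX _ (mem_head t X); rewrite inE negb_or => /andP[].
apply/negP => tspan; suff: coef t (cl t) == 0 by rewrite coef_cl_self // oner_eq0.
rewrite -memv_ker; move: (cl t) tspan.
apply/subvP/span_subvP => _ /mapP[u uX' ->].
rewrite memv_ker coef_cl; last by apply/rX/sX.
case: (u =P t) => [E|_]; first by rewrite -E uX' in tX.
case: (u =P deck_path t) => [E|_]; last by rewrite subr0.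
by rewrite -E uX' in dtX.
Qed.

Lemma dim_span_cl p (P : pred (path_ p)) (X : seq (path_ p)) :
    deck_free X -> {subset X <= P} ->
    (forall t, P t -> (t \in X) || (deck_path t \in X)) ->
  \dim <<[seq cl t | t in P]>> = size X.
Proof.
move=> TX XP PX; rewrite -(size_map (@Defs.cl R D p)).
rewrite -(eqP (free_cl TX)); congr (\dim _).
apply/eqP; rewrite eqEsubv; apply/andP; split; apply/span_subvP.
  move=> _ /imageP[t Pt ->]; case/orP: (PX t Pt) => tX.
    by apply/memv_span/map_f.
  by rewrite -[t]deck_pathK cl_deck memvN; apply/memv_span/map_f.
by move=> _ /mapP[t tX ->]; apply/memv_span/imageP; exists t => //; apply: XP.
Qed.

End SignedChains.

(** * Allowed chains and the complex Omega *)

Section Omega.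
Variables (R : realType) (D : digraph) (s : signing D).

Local Notation path_ := (path_ D).
Local Notation cl := (@cl R D _).
Local Notation coef := (@coef R D _).

Lemma cover_arc_deck u v : cover_arc s (deck u) (deck v) = cover_arc s u v.
Proof.
by apply: eq_existsb => a; rewrite /= addNb (inj_eq negb_inj).
Qed.

Lemma cover_arc_arrow (a : arrow D) b :
  cover_arc s ((val a).1, b) ((val a).2, b (+) s a).
Proof. by apply/existsP; exists a; rewrite -surjective_pairing !eqxx. Qed.

Lemma cover_arcP (u v : lifted D) :
  reflect (exists2 a : arrow D, val a = (u.1, v.1) & v.2 = u.2 (+) s a)
          (cover_arc s u v).
Proof.
apply: (iffP existsP) => -[a] => [/andP[/eqP Ea /eqP Ev]|Ea Ev]; exists a => //.
by rewrite Ea Ev !eqxx.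
Qed.

Lemma cover_arc_base (u v : lifted D) : cover_arc s u v -> arc u.1 v.1.
Proof. by case/cover_arcP => a E _; have := valP a; rewrite E. Qed.

Lemma cover_arc_fun (u v w : lifted D) :
  cover_arc s u v -> cover_arc s u w -> v.1 = w.1 -> v = w.
Proof.
case/cover_arcP => a Ea Eva /cover_arcP[b Eb Ewb] vw.
have Eab : a = b by apply: val_inj; rewrite Ea Eb vw.
by rewrite [v]surjective_pairing [w]surjective_pairing vw Eva Ewb Eab.
Qed.

Lemma cover_arc_neq (u v : lifted D) : cover_arc s u v -> u != v.
Proof.
by move=> /cover_arc_base uv; apply: contraTneq uv => ->; rewrite arc_irr.
Qed.

Lemma allowed_regular p : {subset @allowed D s p <= @regular D p}.
Proof. by move=> t; apply: sub_sorted => u v; exact: cover_arc_neq. Qed.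

Lemma allowed_deck p (t : path_ p) : allowed s (deck_path t) = allowed s t.
Proof.
by rewrite /allowed /= sorted_map; apply: eq_sorted => u v; rewrite /= cover_arc_deck.
Qed.

Lemma allowed_chainP p (z : signed_chain R D p) :
  z \in allowed_chain R s p <-> (forall t, ~~ allowed s t -> coef t z = 0).
Proof.
exact: (span_clP _ (@allowed_regular p) (@allowed_deck p)).
Qed.

Lemma cl_allowed p (t : path_ p) : allowed s t -> cl t \in allowed_chain R s p.
Proof. by move=> At; apply/memv_span/imageP; exists t. Qed.

Lemma dim_allowed0 : \dim (allowed_chain R s 0) = #|D|.
Proof.
rewrite (@dim_span_cl R D 0 _ [seq [tuple (v, false)] | v : D]) ?size_image //.
- split=> [|_ /imageP[v _ ->] //|_ /imageP[v _ ->]].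
    by rewrite map_inj_uniq ?enum_uniq // => v w [].
  by apply/imageP => -[w _ []].
- by move=> _ /imageP[v _ ->].
move=> t _; case/tupleP: t => -[v b] t; rewrite (tuple0 t).
apply/orP; case: b; [right|left]; apply/imageP; exists v => //; exact: val_inj.
Qed.

Definition arrow_path (a : arrow D) : path_ 1 :=
  [tuple ((val a).1, false); ((val a).2, s a)].

Lemma dim_allowed1 : \dim (allowed_chain R s 1) = #|arrow D|.
Proof.
rewrite (@dim_span_cl R D 1 _ [seq arrow_path a | a : arrow D]) ?size_image //.
- have Aa a : allowed s (arrow_path a).
    by have := cover_arc_arrow a false; rewrite /allowed /= => ->.
  split=> [|_ /imageP[a _ ->]|_ /imageP[a _ ->]]; last by apply/imageP => -[w _ []].
    rewrite map_inj_uniq ?enum_uniq // => a b [E1 E2 _]; apply: val_inj.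
    by rewrite [val a]surjective_pairing E1 E2 -surjective_pairing.
  exact: (allowed_regular (Aa a)).
- move=> _ /imageP[a _ ->]; rewrite /in_mem /allowed /= andbT.
  exact: (cover_arc_arrow a false).
move=> t; case/tupleP: t => -[v b] t; case/tupleP: t => -[w c] t.
rewrite (tuple0 t) /allowed /= andbT => /cover_arcP[a /= Ea ->].
apply/orP; case: b; [right|left]; apply/imageP; exists a => //; apply: val_inj;
  by rewrite /= /deck /= /arrow_path /= Ea ?negbK.
Qed.

Lemma bd1 u v : u != v ->
  signed_bd R D 0 (cl [tuple u; v]) = cl [tuple v] - cl [tuple u].
Proof.
move=> uv; rewrite signed_bd_cl /regular /= ?uv // !big_ord_recl big_ord0 addr0.
rewrite expr0 expr1 scale1r scaleN1r.
by congr (cl _ - cl _); apply: val_inj; rewrite val_face.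
Qed.

Lemma bd2 u v w : u != v -> v != w ->
  signed_bd R D 1 (cl [tuple u; v; w]) =
    cl [tuple v; w] - cl [tuple u; w] + cl [tuple u; v].
Proof.
move=> uv vw; rewrite signed_bd_cl /regular /= ?uv ?vw //.
rewrite !big_ord_recl big_ord0 addr0 /= /bump /= sqrrN expr1n.
rewrite expr0 expr1 !scale1r scaleN1r addrA.
by congr (cl _ - cl _ + cl _); apply: val_inj; rewrite val_face.
Qed.

(** The index [lift ord0 ord0] is 1: this face replaces the first two steps of the path by a
    shortcut. *)
Definition skip1 p (t : path_ p.+2) : path_ p.+1 := face (lift ord0 ord0) t.

Lemma val_skip1 p (t : path_ p.+2) :
  val (skip1 t) = head (thead t) t :: drop 2 t.
Proof. by rewrite val_face; case/tupleP: t => a t /=; rewrite take0. Qed.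

Hypothesis no_2cycle : forall x y : D, arc x y -> ~~ arc y x.

Hypothesis uniq_mid : forall x w w' y y' : D,
  arc x w -> arc w y -> arc x w' -> arc w' y' -> w = w'.

(* A face of an allowed path that starts with a non-arrow can only come from  *)
(* deleting the vertex 1, and uniq_mid recovers the path from that face.      *)
Lemma face_eq_skip1 p (q : 'I_p.+3) (t u : path_ p.+2) :
    allowed s t -> ~~ allowed s (skip1 t) -> allowed s u ->
  (face q u == skip1 t) = (q == lift ord0 ord0) && (u == t).
Proof.
move=> At Nt Au; apply/eqP/andP => [|[/eqP-> /eqP-> //]].
move=> /(congr1 val); rewrite val_skip1 val_face.
move: At Nt Au; rewrite /allowed val_skip1.
case/tupleP: t => a t; case/tupleP: t => b t; case/tupleP: t => c t /=.
case/tupleP: u => a' u; case/tupleP: u => b' u; case/tupleP: u => c' u /=.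
move=> /and3P[ab bc ct]; rewrite ct andbT => Nac /and3P[ab' bc' _].
case: q => -[|[|q]] ltq /=; rewrite ?drop0 => -[Ea Eb].
- by rewrite -Ea -Eb bc' in Nac.
- move=> Eu; split; first exact/eqP/val_inj.
  have Ebb : b' = b.
    apply: (cover_arc_fun ab'); first by rewrite Ea.
    apply: (uniq_mid (cover_arc_base ab') (cover_arc_base bc')) => //.
      by rewrite Ea; exact: cover_arc_base ab.
    exact: cover_arc_base bc.
  by apply/eqP/val_inj; rewrite /= Ea Ebb Eb Eu.
by move=> _; rewrite -Ea -Eb ab' in Nac.
Qed.

(** By [face_eq_skip1], [t] is the only allowed path with the face [skip1 t], so if [t] is allowed
    the boundary of [z] has coordinate [- coef t z] there. Since that face is not allowed,
    membership in [Omega] forces this coordinate to be 0. *)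
Lemma Omega_coef p (z : signed_chain R D p.+2) (t : path_ p.+2) :
  z \in Omega R s p.+2 -> ~~ allowed s (skip1 t) -> coef t z = 0.
Proof.
rewrite memv_cap => /andP[/allowed_chainP Az]; rewrite -memv_preim.
move=> /allowed_chainP Abz Nt'.
have [At|/Az//] := boolP (allowed s t).
(* Regularity could fail only if the vertices 0 and 2 of [t] coincided, which would make a 2-cycle
   in [D]. *)
have rt' : regular (skip1 t).
  have := At; rewrite /allowed /regular val_skip1.
  case/tupleP: t {At Nt'} => a t; case/tupleP: t => b t; case/tupleP: t => c t /=.
  case/and3P=> ab bc ct; rewrite (sub_path _ ct) ?andbT.
    by apply: contraTneq (cover_arc_base bc) => <-; exact/no_2cycle/cover_arc_base.
  exact: cover_arc_neq.
have := Abz _ Nt'; rewrite coef_bd // (bigD1 t) //= [X in _ + X]big1 => [|u /negbTE ut].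
  rewrite addr0 (bigD1 (lift ord0 ord0)) //= face_eq_skip1 // !eqxx expr1 mulr1.
  rewrite big1 => [|q /negbTE q1]; last by rewrite face_eq_skip1 // q1 mulr0.
  by move/eqP; rewrite addr0 mulrN1 oppr_eq0 => /eqP.
have [Au|/Az->] := boolP (allowed s u); last by rewrite mul0r.
by rewrite big1 ?mulr0 // => q _; rewrite face_eq_skip1 // ut andbF mulr0.
Qed.

(** In an allowed path of length at least 3 the vertex 2 has a successor, so there is no shortcut
    from vertex 0 to vertex 2, and [Omega_coef] applies to every allowed path. *)
Lemma Omega_eq0 p :
    (forall x y z w : D, arc x y -> arc y z -> arc z w -> ~~ arc x z) ->
  Omega R s p.+3 = 0%VS.
Proof.
move=> no_tri; apply/eqP; rewrite -subv0; apply/subvP => z Oz; rewrite memv0.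
apply/eqP/coef_inj => t; rewrite linear0.
have [At|Nt] := boolP (allowed s t).
  apply: (Omega_coef Oz); move: At; rewrite /allowed val_skip1.
  case/tupleP: t => a t; case/tupleP: t => b t; case/tupleP: t => c t.
  case/tupleP: t => d t /= /and4P[ab bc cd _].
  apply: contra (no_tri _ _ _ _ (cover_arc_base ab) (cover_arc_base bc) (cover_arc_base cd)).
  by move=> /andP[/cover_arc_base].
by move: Oz; rewrite memv_cap => /andP[/allowed_chainP->].
Qed.

Definition transitive_triangle (t : path_ 2) := allowed s t && allowed s (skip1 t).

(** [Omega_coef] removes every path without an allowed shortcut; conversely, all three faces of a
    transitive triangle are allowed. *)
Lemma Omega2_span :
  Omega R s 2 = <<[seq cl t | t in transitive_triangle]>>%VS.
Proof.
have TR : {subset transitive_triangle <= @regular D 2}.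
  by move=> t /andP[/allowed_regular].
have TD t : transitive_triangle (deck_path t) = transitive_triangle t.
  by rewrite /transitive_triangle allowed_deck /skip1 face_deck allowed_deck.
apply/eqP; rewrite eqEsubv; apply/andP; split.
  apply/subvP => z Oz; apply/(span_clP _ TR TD) => t.
  rewrite negb_and => /orP[Nt|]; last exact: Omega_coef.
  by move: Oz; rewrite memv_cap => /andP[/allowed_chainP->].
apply/span_subvP => _ /imageP[t /andP[At At'] ->].
rewrite memv_cap cl_allowed //= -memv_preim.
rewrite signed_bd_cl; last exact: allowed_regular.
apply: memv_suml => q _; apply: memvZ; apply: cl_allowed.
case: q => -[|[|[|//]]] ltq.
- move: At {At'}; rewrite /allowed val_face; case/tupleP: t => a t.
  by case/tupleP: t => b t; case/tupleP: t => c t /= /and3P[_ -> ->].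
- by rewrite (_ : Ordinal _ = lift ord0 ord0); [exact: At'|exact: val_inj].
move: At {At'}; rewrite /allowed val_face; case/tupleP: t => a t.
by case/tupleP: t => b t; case/tupleP: t => c t; rewrite (tuple0 t) /= => /andP[->].
Qed.

Lemma bd_bd_Omega2 (z : signed_chain R D 2) :
  z \in Omega R s 2 -> signed_bd R D 0 (signed_bd R D 1 z) = 0.
Proof.
rewrite Omega2_span -comp_lfunE => Oz; apply/eqP; rewrite -memv_ker.
move: z Oz; apply/subvP/span_subvP => _ /imageP[t /andP[At At'] ->].
move: At At'; rewrite memv_ker /allowed val_skip1; case/tupleP: t => a t.
case/tupleP: t => b t; case/tupleP: t => c t /=; rewrite (tuple0 t) /= !andbT.
move=> /andP[/cover_arc_neq ab /cover_arc_neq bc] /cover_arc_neq ac.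
rewrite comp_lfunE [X in cl X](_ : _ = [tuple a; b; c]); last exact: val_inj.
rewrite bd2 // linearD linearB /= !bd1 //.
by rewrite opprB [X in X + _]addrC !subrKA subrr.
Qed.

Lemma boundaries_sub_cycles1 : (boundaries R s 1 <= cycles R s 1)%VS.
Proof.
apply/subvP => _ /memv_imgP[z Oz ->].
rewrite !memv_cap -memv_preim memv_ker bd_bd_Omega2 // mem0v eqxx !andbT.
by move: Oz; rewrite memv_cap -memv_preim => /andP[].
Qed.

Lemma boundaries_sub_cycles0 : (boundaries R s 0 <= cycles R s 0)%VS.
Proof.
apply/subvP => _ /memv_imgP[z Oz ->].
by move: Oz; rewrite memv_cap -memv_preim => /andP[].
Qed.

Lemma dim_cycles_boundaries p :
  (\dim (cycles R s p.+1) + \dim (boundaries R s p) = \dim (Omega R s p.+1))%N.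
Proof. exact: limg_ker_dim. Qed.

End Omega.

(** * Signs of arrows and triangles, and the rank of the signed incidence map *)

Section Signs.
Variables (R : realType) (D : digraph) (s : signing D).

Local Notation path_ := (path_ D).
Local Notation cl := (@cl R D _).
Local Notation coef := (@coef R D _).

Definition sign (x y : D) : bool :=
  if insub (x, y) is Some a then s (a : arrow D) else false.

Lemma signE (a : arrow D) : sign (val a).1 (val a).2 = s a.
Proof. by rewrite /sign -surjective_pairing valK. Qed.

Lemma cover_arcE (u v : lifted D) :
  cover_arc s u v = arc u.1 v.1 && (v.2 == u.2 (+) sign u.1 v.1).
Proof.
apply/cover_arcP/andP => [[a Ea ->]|[uv /eqP->]].
  by have := valP a; rewrite -signE Ea.
by exists (Sub (u.1, v.1) uv); rewrite ?SubK // -signE SubK.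
Qed.

Definition edge_path (x y : D) : path_ 1 := [tuple (x, false); (y, sign x y)].

(** The lift of the walk that starts on the sheet [false]: each later sheet is the product of the
    signs met so far. *)
Definition triangle_path (x y z : D) : path_ 2 :=
  [tuple (x, false); (y, sign x y); (z, sign x y (+) sign y z)].

Lemma arc_neq (x y : D) b c : arc x y -> (x, b) != (y, c) :> lifted D.
Proof. by move=> xy; apply: contraTneq xy => -[-> _]; rewrite arc_irr. Qed.

Lemma regular_edge x y : arc x y -> regular (edge_path x y).
Proof. by move=> xy; rewrite /regular /= arc_neq. Qed.

Lemma regular_triangle x y z : arc x y -> arc y z -> regular (triangle_path x y z).
Proof. by move=> xy yz; rewrite /regular /= !arc_neq. Qed.

Lemma coef_edge x y x' y' : arc x' y' ->
  coef (edge_path x y) (cl (edge_path x' y')) = ((x', y') == (x, y))%:R.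
Proof.
move=> a'; rewrite coef_cl ?regular_edge //.
have -> : (edge_path x' y' == deck_path (edge_path x y)) = false by apply/eqP => -[].
rewrite subr0; congr (_%:R); congr nat_of_bool.
by apply/eqP/eqP => [[-> -> _]|[-> ->]].
Qed.

Lemma cl_deck_sign p (t : path_ p) (b : bool) :
  cl (if b then deck_path t else t) = (-1) ^+ b *: cl t.
Proof. by case: b; rewrite ?scale1r // cl_deck expr1 scaleN1r. Qed.

(** The face from [y] to [z] starts on the sheet [sign x y] and not on [false], whence its factor;
    balance puts the face from [x] to [z] on the correct lift. *)
Lemma bd_triangle x y z : arc x y -> arc y z -> arc x z ->
    sign x z = sign x y (+) sign y z ->
  signed_bd R D 1 (cl (triangle_path x y z)) =
    (-1) ^+ sign x y *: cl (edge_path y z) - cl (edge_path x z)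
      + cl (edge_path x y).
Proof.
move=> xy yz xz E; rewrite bd2 ?arc_neq //; congr (_ - _ + _).
  rewrite -cl_deck_sign; congr cl; apply: val_inj.
  by case: (sign x y).
by rewrite -E.
Qed.

Lemma transitive_triangleE x y z : arc x y -> arc y z -> arc x z ->
  transitive_triangle s (triangle_path x y z) = (sign x z == sign x y (+) sign y z).
Proof.
move=> xy yz xz; rewrite /transitive_triangle /allowed val_skip1 /= !cover_arcE /=.
by rewrite xy yz xz !eqxx /= andbT eq_sym.
Qed.

Lemma transitive_triangle_path t : transitive_triangle s t ->
  exists x y z b, [/\ arc x y, arc y z, arc x z,
    sign x z = sign x y (+) sign y z &
    t = if b then deck_path (triangle_path x y z) else triangle_path x y z].
Proof.
rewrite /transitive_triangle /allowed val_skip1.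
case/tupleP: t => -[x b] t; case/tupleP: t => -[y c] t; case/tupleP: t => -[z d] t.
rewrite (tuple0 t) /= !cover_arcE /= !andbT.
case/andP=> /andP[/andP[xy /eqP->] /andP[yz /eqP->]] /andP[xz].
rewrite -addbA (inj_eq (@addbI b)) => /eqP E.
by exists x, y, z, b; split => //; apply: val_inj; case: b.
Qed.

(** In degree 1 the boundary condition is empty, since every vertex is an allowed path. *)
Lemma Omega1E : Omega R s 1 = allowed_chain R s 1.
Proof.
apply/eqP; rewrite eqEsubv capvSl subv_cap subvv /=.
apply/span_subvP => _ /imageP[t + ->]; case/tupleP: t => u t; case/tupleP: t => v t.
rewrite (tuple0 t) unfold_in /= andbT => /cover_arc_neq uv; rewrite -memv_preim.
rewrite [X in cl X](_ : _ = [tuple u; v]); last exact: val_inj.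
by rewrite bd1 // memvB // cl_allowed.
Qed.

Definition vertex_class x b := cl [tuple ((x, b) : lifted D)].

Lemma vertex_classE x b : vertex_class x b = (-1) ^+ b *: vertex_class x false.
Proof.
rewrite -cl_deck_sign /vertex_class; congr cl; apply: val_inj; by case: b.
Qed.

Lemma boundaries0_arrow (a : arrow D) b :
  vertex_class (val a).2 (b (+) s a) - vertex_class (val a).1 b
    \in boundaries R s 0.
Proof.
have ca := cover_arc_arrow s a b.
rewrite -bd1 ?(cover_arc_neq ca) // memv_img // memv_cap -memv_preim.
rewrite cl_allowed /allowed /= ?ca // bd1 ?(cover_arc_neq ca) //.
by rewrite memvB // cl_allowed.
Qed.

Variables (r : D) (eta : D -> bool).

(** Transport of signs along a spanning tree rooted at [r] supplies such an [eta]; modulo boundaries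
    every vertex class is then plus or minus the root class. *)
Hypothesis eta_boundary :
  forall x, vertex_class x (eta x) - vertex_class r false \in boundaries R s 0.

Lemma vertex_class_mod x b :
  vertex_class x b - (-1) ^+ (b (+) eta x) *: vertex_class r false
    \in boundaries R s 0.
Proof.
rewrite -[b in vertex_class x b](addbK (eta x)) vertex_classE.
have := memvZ ((-1) ^+ (b (+) eta x)) (eta_boundary x).
by rewrite scalerBr (vertex_classE x (eta x)) scalerA -signr_addb.
Qed.

Lemma dim_boundaries0_bounds :
  (\dim (boundaries R s 0) <= #|D| <= (\dim (boundaries R s 0)).+1)%N.
Proof.
rewrite -(dim_allowed0 R s) dimvS; last exact: boundaries_sub_cycles0.
rewrite -addn1; have := dim_vline (vertex_class r false).
have /dimvS/leq_trans -> // : (allowed_chain R s 0 <=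
    boundaries R s 0 + <[vertex_class r false]>)%VS.
  apply/span_subvP => _ /imageP[t _ ->].
  case/tupleP: t => -[x b] t; rewrite (tuple0 t).
  have -> : cl [tuple of (x, b) :: [tuple]] = vertex_class x b.
    by congr cl; apply: val_inj.
  rewrite -[vertex_class x b](subrK ((-1) ^+ (b (+) eta x) *: vertex_class r false)).
  by rewrite memv_add ?vertex_class_mod // memvZ // memv_line.
apply: leq_trans (dimv_add_leqif _ _) _.
by rewrite leq_add2l dim_vline leq_b1.
Qed.

(** Going out to the tail of the bad arrow, across it and back to the root reverses the sign, so
    twice the root class is a boundary; hence so is every vertex class. *)
Lemma dim_boundaries0_unbalanced (a : arrow D) :
  s a != eta (val a).1 (+) eta (val a).2 -> \dim (boundaries R s 0) = #|D|.
Proof.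
move=> Na; rewrite -(dim_allowed0 R s); congr (\dim _); apply/eqP.
rewrite eqEsubv boundaries_sub_cycles0 /=.
have two0 : 2%:R != 0 :> R by rewrite pnatr_eq0.
have rB : vertex_class r false \in boundaries R s 0.
  have := vertex_class_mod (val a).2 (eta (val a).1 (+) s a).
  have -> : (eta (val a).1 (+) s a) (+) eta (val a).2 = true.
    by move: Na; do 2!case: (eta _); case: (s a).
  rewrite expr1 scaleN1r opprK => /(memvB (boundaries0_arrow a (eta (val a).1))).
  move=> /memvD/(_ (eta_boundary (val a).1)).
  rewrite opprD addrACA subrK -addrA addNKr -opprD memvN -mulr2n.
  rewrite -scaler_nat => /(memvZ 2%:R^-1).
  by rewrite scalerA mulVf // scale1r.
apply/span_subvP => _ /imageP[t _ ->].
case/tupleP: t => -[x b] t; rewrite (tuple0 t).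
have -> : cl [tuple of (x, b) :: [tuple]] = vertex_class x b.
  by congr cl; apply: val_inj.
rewrite -[vertex_class x b](subrK ((-1) ^+ (b (+) eta x) *: vertex_class r false)).
by rewrite memvD ?vertex_class_mod // memvZ.
Qed.

Lemma dim_boundaries0_balanced :
    (forall a : arrow D, s a = eta (val a).1 (+) eta (val a).2) ->
  (\dim (boundaries R s 0)).+1 = #|D|.
Proof.
move=> bal; apply/eqP; rewrite eqn_leq.
have /andP[_ ->] := dim_boundaries0_bounds; rewrite andbT.
rewrite -(dim_allowed0 R s).
(* The augmentation twisted by the switching function: it vanishes on boundaries but equals 1 or -1
   on each vertex class, so the boundaries are a proper subspace. *)
pose f : 'Hom(signed_chain R D 0, R^o) :=
  \sum_x (-1) ^+ eta x *: coef [tuple ((x, false) : lifted D)].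
have fv x b : f (vertex_class x b) = (-1) ^+ (b (+) eta x).
  rewrite vertex_classE linearZ /= sum_lfunE (bigD1 x) //= big1 => [|y yx].
    rewrite addr0 scale_lfunE coef_cl_self //.
    by rewrite /GRing.scale /= mulr1 -signr_addb.
  rewrite scale_lfunE coef_cl // (_ : (_ == _) = false); last first.
    by apply/eqP => -[E]; rewrite E eqxx in yx.
  rewrite (_ : (_ == _) = false) ?subr0 ?scaler0 //; by apply/eqP => -[].
have Bf : (boundaries R s 0 <= lker f)%VS.
  apply/subvP => _ /memv_imgP[z Oz ->]; rewrite memv_ker -comp_lfunE -memv_ker.
  have : z \in allowed_chain R s 1 by move: Oz; rewrite memv_cap => /andP[].
  move: z {Oz}; apply/subvP/span_subvP => _ /imageP[t + ->].
  case/tupleP: t => u t; case/tupleP: t => v t; rewrite (tuple0 t).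
  rewrite unfold_in /= andbT => uv; rewrite memv_ker comp_lfunE.
  rewrite [X in cl X](_ : _ = [tuple u; v]); last exact: val_inj.
  rewrite bd1 ?(cover_arc_neq uv) // linearB /=.
  case/cover_arcP: uv => a Ea Ev.
  case: u v Ea Ev => x b [y c] Ea /= ->.
  rewrite !fv bal Ea /= (_ : _ (+) eta y = b (+) eta x) ?subrr //.
  by rewrite -!addbA addbb addbF.
rewrite ltn_neqAle dimvS ?boundaries_sub_cycles0 // andbT.
apply/negP => /eqP E.
have /eqP EV : (boundaries R s 0 == allowed_chain R s 0)%VS.
  by rewrite eqEdim boundaries_sub_cycles0 /= E.
have : vertex_class r false \in boundaries R s 0 by rewrite EV cl_allowed.
by move/(subvP Bf); rewrite memv_ker fv signr_eq0.
Qed.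

End Signs.

(** * The digraph D9 *)

Definition v0 : D9 := @Ordinal 5 0 isT.
Definition v1 : D9 := @Ordinal 5 1 isT.
Definition v2 : D9 := @Ordinal 5 2 isT.
Definition v3 : D9 := @Ordinal 5 3 isT.
Definition v4 : D9 := @Ordinal 5 4 isT.

Definition edges : seq (D9 * D9) :=
  [:: (v0, v1); (v1, v2); (v2, v0); (v0, v3); (v1, v3); (v2, v3);
      (v0, v4); (v1, v4); (v2, v4)].

Definition triangles : seq (D9 * D9 * D9) :=
  [:: (v0, v1, v3); (v1, v2, v3); (v2, v0, v3);
      (v0, v1, v4); (v1, v2, v4); (v2, v0, v4)].

Lemma D9_ind (P : D9 -> Prop) :
  P v0 -> P v1 -> P v2 -> P v3 -> P v4 -> forall x, P x.
Proof.
move=> P0 P1 P2 P3 P4 [[|[|[|[|[|//]]]]] ltx].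
- by rewrite (_ : Ordinal ltx = v0) //; apply: val_inj.
- by rewrite (_ : Ordinal ltx = v1) //; apply: val_inj.
- by rewrite (_ : Ordinal ltx = v2) //; apply: val_inj.
- by rewrite (_ : Ordinal ltx = v3) //; apply: val_inj.
by rewrite (_ : Ordinal ltx = v4) //; apply: val_inj.
Qed.

Lemma mem_edges (x y : D9) : ((x, y) \in edges) = arc x y.
Proof. by elim/D9_ind: x; elim/D9_ind: y. Qed.

Lemma no_2cycle9 (x y : D9) : arc x y -> ~~ arc y x.
Proof. by elim/D9_ind: x; elim/D9_ind: y. Qed.

Lemma uniq_mid9 (x w w' y y' : D9) :
  arc x w -> arc w y -> arc x w' -> arc w' y' -> w = w'.
Proof.
(* Only the vertices of the directed 3-cycle have successors. Using this for [y] and [y'] leaves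
   just three vertices to enumerate. *)
pose inner (w : D9) := w \in [:: v0; v1; v2].
have innerP u v : arc u v -> inner u by elim/D9_ind: u; elim/D9_ind: v.
move=> xw /innerP wi xw' /innerP; move: xw wi xw'.
by elim/D9_ind: x; elim/D9_ind: w; elim/D9_ind: w'.
Qed.

Lemma no_tri9 (x y z w : D9) : arc x y -> arc y z -> arc z w -> ~~ arc x z.
Proof.
pose inner (w : D9) := w \in [:: v0; v1; v2].
have innerP u v : arc u v -> inner u by elim/D9_ind: u; elim/D9_ind: v.
move=> xy yz /innerP; move: xy yz.
by elim/D9_ind: x; elim/D9_ind: y; elim/D9_ind: z.
Qed.

Lemma mem_triangles x y z :
  ((x, y, z) \in triangles) = [&& arc x y, arc y z & arc x z].
Proof. by elim/D9_ind: x; elim/D9_ind: y; elim/D9_ind: z. Qed.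

Definition base_cycle : seq (D9 * D9) := [:: (v0, v1); (v1, v2); (v2, v0)].

Lemma mem_fan e k : e \in base_cycle -> k \in [:: v3; v4] -> (e, k) \in triangles.
Proof.
move=> ee kk; have : (e, k) \in [seq (e, k) | e <- base_cycle, k <- [:: v3; v4]].
  exact: allpairs_f.
by move: {ee kk} (e, k); apply/allP.
Qed.

Lemma card_arrow9 : #|arrow D9| = 9%N.
Proof.
rewrite card_sig -[RHS]/(size edges) -(card_uniqP (isT : uniq edges)).
by apply: eq_card => -[x y]; rewrite mem_edges.
Qed.

(** * Algebraic identities behind the 2-cycles *)

Lemma addr_eq0_eq (V : zmodType) (a b : V) : a + b = 0 -> (a == 0) = (b == 0).
Proof. by move/eqP; rewrite addr_eq0 => /eqP->; rewrite oppr_eq0. Qed.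

(* The equations say that the coefficients are constant up to sign along each *)
(* fan of three triangles, and opposite on the two triangles at a cycle edge. *)
Lemma triangle_equations (K : idomainType) (c : D9 * D9 * D9 -> K)
    (g : D9 -> D9 -> bool) :
    (forall x y, \sum_(T <- triangles) c T *
      ((-1) ^+ g T.1.1 T.1.2 * ((T.1.2, T.2) == (x, y))%:R
       - ((T.1.1, T.2) == (x, y))%:R + (T.1 == (x, y))%:R) = 0) ->
  {in triangles &, forall T T', c T = 0 -> c T' = 0}.
Proof.
move=> E.
have zN a : (a * -1 == 0 :> K) = (a == 0) by rewrite mulrN1 oppr_eq0.
have zg a b : (a * (-1) ^+ b == 0 :> K) = (a == 0).
  by rewrite mulf_eq0 signr_eq0 orbF.
have simp := (mulr0, mulr1, addr0, add0r, subr0, oppr0, sub0r).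
have E01 : (c (v0, v1, v3) == 0) = (c (v0, v1, v4) == 0).
  by move: (E v0 v1); rewrite unlock /= !simp => /addr_eq0_eq.
have E12 : (c (v1, v2, v3) == 0) = (c (v1, v2, v4) == 0).
  by move: (E v1 v2); rewrite unlock /= !simp => /addr_eq0_eq.
have E20 : (c (v2, v0, v3) == 0) = (c (v2, v0, v4) == 0).
  by move: (E v2 v0); rewrite unlock /= !simp => /addr_eq0_eq.
have E03 : (c (v0, v1, v3) == 0) = (c (v2, v0, v3) == 0).
  by move: (E v0 v3); rewrite unlock /= !simp => /addr_eq0_eq; rewrite zN zg.
have E13 : (c (v0, v1, v3) == 0) = (c (v1, v2, v3) == 0).
  by move: (E v1 v3); rewrite unlock /= !simp => /addr_eq0_eq; rewrite zN zg.
have zz T : T \in triangles -> (c T == 0) = (c (v0, v1, v3) == 0).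
  rewrite !inE.
  by do ![case/predU1P => [->|]]; [..|move/eqP->]; rewrite -?E01 -?E12 -?E20 -?E03 -?E13.
by move=> T T' /zz zT /zz zT' /eqP; rewrite zT -zT' => /eqP.
Qed.

Lemma sum_base_cycle (V : zmodType) (w : D9 -> V) :
  \sum_(e <- base_cycle) (w e.2 - w e.1) = 0.
Proof.
rewrite unlock /= addr0 addrC -addrA [_ + (w v1 - _)]addrC.
by rewrite !subrKA subrr.
Qed.

(** Applied to the boundaries of the two triangles over one edge of the directed 3-cycle: that edge
    [r] cancels, and what remains is a difference of spoke terms, ready to telescope in
    [sum_base_cycle]. *)
Lemma signed_fan_diff (K : pzRingType) (V : lmodType K) (a g : bool)
    (p p' q q' r : V) :
  (-1) ^+ a *: (((-1) ^+ g *: p - q + r) - ((-1) ^+ g *: p' - q' + r)) =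
  (-1) ^+ (a (+) g) *: (p - p') - (-1) ^+ a *: (q - q').
Proof.
rewrite signr_addb -scalerA -[RHS]scalerBr; congr (_ *: _).
by rewrite scalerBr opprD addrACA subrr addr0 opprD addrACA -opprD.
Qed.

(** * The complex of a signing of [D9] *)

Section Signing.
Variables (R : realType) (s : signing D9).

Local Notation cl := (@cl R D9 _).
Local Notation coef := (@coef R D9 _).

Definition balanced_triangle (T : D9 * D9 * D9) : bool :=
  let: (x, y, z) := T in sign s x z == sign s x y (+) sign s y z.

Definition balanced_count : nat := count balanced_triangle triangles.

Definition triangle9 (T : D9 * D9 * D9) : path_ D9 2 :=
  let: (x, y, z) := T in triangle_path s x y z.

Lemma triangle9_inj : injective triangle9.
Proof. by move=> [[x y] z] [[x' y'] z'] [-> -> _ -> _]. Qed.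

Lemma deck_free_triangle9 X : uniq X -> {subset X <= triangles} ->
  deck_free [seq triangle9 T | T <- X].
Proof.
move=> uX sX; split.
- by rewrite map_inj_uniq //; exact: triangle9_inj.
- move=> _ /mapP[[[x y] z] /sX + ->]; rewrite mem_triangles => /and3P[xy yz _].
  exact: regular_triangle.
by move=> _ /mapP[[[x y] z] _ ->]; apply/mapP => -[[[x' y'] z'] _ []].
Qed.

Lemma transitive_triangle9 t : transitive_triangle s t ->
  exists T b, [/\ T \in triangles, balanced_triangle T &
    t = if b then deck_path (triangle9 T) else triangle9 T].
Proof.
case/transitive_triangle_path=> x [y [z [b [xy yz xz E Et]]]].
by exists (x, y, z), b; split=> //; rewrite ?mem_triangles ?xy ?yz //= E.
Qed.

Lemma Omega9_eq0 p : Omega R s p.+3 = 0%VS.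
Proof. exact: (Omega_eq0 R s no_2cycle9 uniq_mid9 p no_tri9). Qed.

Lemma Omega9_2_span :
  Omega R s 2 = <<[seq cl t | t in transitive_triangle s]>>%VS.
Proof. exact: (Omega2_span R s no_2cycle9 uniq_mid9). Qed.

Lemma dim_Omega9_2 : \dim (Omega R s 2) = balanced_count.
Proof.
rewrite Omega9_2_span /balanced_count -size_filter -(size_map triangle9).
apply: dim_span_cl.
- apply: deck_free_triangle9 => [|T]; first exact: filter_uniq.
  by rewrite mem_filter => /andP[].
- move=> _ /mapP[[[x y] z] + ->]; rewrite mem_filter mem_triangles.
  by case/and4P => E xy yz xz; rewrite -topredE /= transitive_triangleE.
move=> t /transitive_triangle9[T [b [TT TB ->]]].
have TX : triangle9 T \in [seq triangle9 T | T <- triangles & balanced_triangle T].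
  by rewrite map_f // mem_filter TB.
by case: b; rewrite ?deck_pathK TX ?orbT.
Qed.

Lemma Omega9_2_coef z t : z \in Omega R s 2 ->
  ~~ transitive_triangle s t -> coef t z = 0.
Proof.
move=> Oz; rewrite negb_and => /orP[Nt|]; last first.
  exact: (Omega_coef no_2cycle9 uniq_mid9).
by move: Oz; rewrite memv_cap => /andP[/allowed_chainP->].
Qed.

Lemma Omega9_2_expand z : z \in Omega R s 2 ->
  z = \sum_(T <- triangles) coef (triangle9 T) z *: cl (triangle9 T).
Proof.
move=> Oz; rewrite -(big_map triangle9 xpredT (fun t => coef t z *: cl t)).
apply: deck_free_expand => [|t NX NdX]; first exact: deck_free_triangle9.
apply: (Omega9_2_coef Oz); apply/negP => /transitive_triangle9[T [b [TT _ Et]]].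
have := map_f triangle9 TT; case: b Et => Et.
  by rewrite -[triangle9 T]deck_pathK -Et (negbTE NdX).
by rewrite -Et (negbTE NX).
Qed.

Lemma bd_Omega9_2 z : z \in Omega R s 2 ->
  signed_bd R D9 1 z = \sum_(T <- triangles) coef (triangle9 T) z *:
    ((-1) ^+ sign s T.1.1 T.1.2 *: cl (edge_path s T.1.2 T.2)
     - cl (edge_path s T.1.1 T.2) + cl (edge_path s T.1.1 T.1.2)).
Proof.
move=> Oz; rewrite {1}(Omega9_2_expand Oz) linear_sum [LHS]big_seq [RHS]big_seq.
apply: eq_bigr => -[[x y] z'] TT; move: (TT); rewrite mem_triangles => /and3P[xy yz xz].
rewrite linearZ /=.
(* The boundary formula is valid for balanced triangles only, but the unbalanced ones have
   coefficient 0 in [z]; this allows a sum over all six triangles. *)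
have [/eqP E|N] := boolP (balanced_triangle (x, y, z')).
  by rewrite bd_triangle.
by rewrite (Omega9_2_coef Oz) ?scale0r // transitive_triangleE.
Qed.

Lemma coef_bd_Omega9_2 z x y : z \in Omega R s 2 ->
  coef (edge_path s x y) (signed_bd R D9 1 z) =
    \sum_(T <- triangles) coef (triangle9 T) z *
      ((-1) ^+ sign s T.1.1 T.1.2 * ((T.1.2, T.2) == (x, y))%:R
       - ((T.1.1, T.2) == (x, y))%:R + (T.1 == (x, y))%:R).
Proof.
move=> Oz; rewrite (bd_Omega9_2 Oz) linear_sum [LHS]big_seq [RHS]big_seq.
apply: eq_bigr => -[[x' y'] z'] TT; move: (TT); rewrite mem_triangles => /and3P[xy yz xz].
by rewrite linearZ /= linearD linearB linearZ /= !coef_edge.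
Qed.

Lemma cycle9_eq0 z T : z \in cycles R s 2 ->
  T \in triangles -> coef (triangle9 T) z = 0 -> z = 0.
Proof.
rewrite memv_cap memv_ker => /andP[Oz /eqP dz] TT cT; rewrite (Omega9_2_expand Oz).
rewrite big_seq big1 // => T' TT'.
have E x y := etrans (esym (coef_bd_Omega9_2 x y Oz)) (etrans (congr1 _ dz) (linear0 _)).
by rewrite (@triangle_equations R (fun T => coef (triangle9 T) z) _ E T) // scale0r.
Qed.

(* The switching function forced by eta 0 = + along a spanning tree. *)
Definition eta9 (x : D9) : bool :=
  nth false [:: false; sign s v0 v1; sign s v2 v0; sign s v0 v3; sign s v0 v4] x.

Lemma balanced_countE : [\/ balanced_count = 0%N, balanced_count = 2%N,
  balanced_count = 4%N | balanced_count = 6%N].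
Proof.
rewrite /balanced_count /=.
do 9![case: (sign s _ _)]; by [apply: Or41|apply: Or42|apply: Or43|apply: Or44].
Qed.

(** The tree consists of 0->1, 2->0, 0->3 and 0->4. Of the other arrows, 1->3, 2->3, 1->4 and 2->4
    each complete a triangle with two tree arrows; then 1->2 is settled by the triangle (1,2,3). *)
Lemma balanced_eta9 (a : arrow D9) : balanced_count = 6%N ->
  s a = eta9 (val a).1 (+) eta9 (val a).2.
Proof.
rewrite -(signE s a); case: a => -[x y] xy; have : arc x y by [].
rewrite -mem_edges !inE /balanced_count /= {xy}.
by do ![case/predU1P => [[-> ->]|]]; [..|case/eqP=> -> ->];
  rewrite /eta9 /=; do 9![case: (sign s _ _)].
Qed.

Lemma switching_balanced_count : switching_balanced s <-> balanced_count = 6%N.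
Proof.
split=> [[eta bal]|/balanced_eta9 bal]; last by exists eta9.
have E x y : arc x y -> sign s x y = eta x (+) eta y.
  by move=> xy; have := bal (Sub (x, y) xy); rewrite -signE SubK.
rewrite /balanced_count /= !E //.
by do 5!case: (eta _).
Qed.

Lemma eta9_boundary x :
  vertex_class R x (eta9 x) - vertex_class R v0 false \in boundaries R s 0.
Proof.
have B x' y b (xy : arc x' y) : vertex_class R y (b (+) sign s x' y) -
    vertex_class R x' b \in boundaries R s 0.
  by have := boundaries0_arrow R s (Sub (x', y) xy) b; rewrite -signE SubK.
elim/D9_ind: x.
- by rewrite subrr mem0v.
- exact: (B v0 v1 false isT).
(* The arrow 2->0 is used backwards: starting from the sheet [sign s v2 v0], it arrives at the sheet
   [false] over the root. *)
- have := B v2 v0 (sign s v2 v0) isT.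
  by rewrite addbb -memvN opprB.
- exact: (B v0 v3 false isT).
exact: (B v0 v4 false isT).
Qed.

Lemma dim_boundaries9_0 :
  (\dim (boundaries R s 0) + (balanced_count == 6))%N = 5%N.
Proof.
rewrite -[RHS](card_ord 5); case: eqP => [/balanced_eta9 bal|Nbal].
  by rewrite addn1; apply: (dim_boundaries0_balanced eta9_boundary).
have [a Na] : exists a : arrow D9, s a != eta9 (val a).1 (+) eta9 (val a).2.
  apply/existsP; apply: contra_notT Nbal => /existsPn H.
  apply/switching_balanced_count; exists eta9 => a; apply/eqP; exact/negPn/H.
by rewrite addn0 (dim_boundaries0_unbalanced eta9_boundary Na).
Qed.

(** * The space of 2-cycles *)

Lemma coef_triangle9 T T' : T' \in triangles ->
  coef (triangle9 T) (cl (triangle9 T')) = (T' == T)%:R.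
Proof.
case: T' => [[x y] z]; rewrite mem_triangles => /and3P[xy yz _].
rewrite coef_cl ?regular_triangle // (inj_eq triangle9_inj).
rewrite (_ : (_ == deck_path _) = false) ?subr0 //.
by case: T => [[x' y'] z']; apply/eqP => -[].
Qed.

(* The sum of the two fans, with opposite signs, lifted along eta9. *)
Definition fan_cycle : signed_chain R D9 2 :=
  \sum_(e <- base_cycle) (-1) ^+ eta9 e.1 *:
    (cl (triangle9 (e, v3)) - cl (triangle9 (e, v4))).

(** The root has [eta9 v0 = false], so this coefficient is normalized to 1; in particular
    [fan_cycle] is nonzero. *)
Lemma coef_fan_cycle : coef (triangle9 (v0, v1, v3)) fan_cycle = 1.
Proof.
rewrite linear_sum big_seq (eq_bigr (fun e => (-1) ^+ eta9 e.1 *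
  (((e, v3) == (v0, v1, v3))%:R - ((e, v4) == (v0, v1, v3))%:R))) => [|e ee].
  by rewrite -big_seq unlock /= !(subr0, mulr0, addr0, mulr1).
by rewrite linearZ linearB -!coef_triangle9 ?mem_fan.
Qed.

Lemma fan_cycle_cycle : balanced_count = 6%N -> fan_cycle \in cycles R s 2.
Proof.
move=> bal; have E x y : arc x y -> sign s x y = eta9 x (+) eta9 y.
  by move=> xy; have := balanced_eta9 (Sub (x, y) xy) bal; rewrite -signE SubK.
have Hk e k : e \in base_cycle -> k \in [:: v3; v4] ->
    [&& arc e.1 e.2, arc e.2 k & arc e.1 k].
  by move=> ee kk; rewrite -mem_triangles -surjective_pairing mem_fan.
have sgn x y k : arc x y -> arc y k -> arc x k ->
    sign s x k = sign s x y (+) sign s y k.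
  by move=> xy yk xk; rewrite !E // addbA addbK.
rewrite memv_cap; apply/andP; split.
  rewrite Omega9_2_span /fan_cycle big_seq; apply: memv_suml => -[x y] exy.
  apply: memvZ; apply: memvB; apply/memv_span/imageP.
    have /and3P[xy yk xk] := Hk _ v3 exy isT; exists (triangle9 (x, y, v3)) => //.
    by rewrite -topredE /= transitive_triangleE // -sgn // xy yk xk.
  have /and3P[xy yk xk] := Hk _ v4 exy isT; exists (triangle9 (x, y, v4)) => //.
  by rewrite -topredE /= transitive_triangleE // -sgn // xy yk xk.
(* A potential on the vertices of the 3-cycle: the summand of [fan_cycle] at the edge [e] has
   boundary [w e.2 - w e.1], so the sum around the cycle vanishes. *)
pose w x := (-1) ^+ eta9 x *: (cl (edge_path s x v3) - cl (edge_path s x v4)).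
rewrite memv_ker linear_sum big_seq.
rewrite (eq_bigr (fun e => w e.2 - w e.1)) => [|[x y] exy].
  by rewrite -big_seq sum_base_cycle.
have /and3P[xy y3 x3] := Hk _ v3 exy isT; have /and3P[_ y4 x4] := Hk _ v4 exy isT.
transitivity ((-1) ^+ eta9 x *: (signed_bd R D9 1 (cl (triangle_path s x y v3)) -
    signed_bd R D9 1 (cl (triangle_path s x y v4)))); first by rewrite linearZ linearB.
rewrite (bd_triangle R xy y3 x3 (sgn _ _ _ xy y3 x3)).
rewrite (bd_triangle R xy y4 x4 (sgn _ _ _ xy y4 x4)).
by rewrite signed_fan_diff E // addKb.
Qed.

(** Subtracting from a 2-cycle the multiple of [fan_cycle] that matches its coefficient at one
    triangle leaves a cycle with a zero coefficient, which [cycle9_eq0] annihilates. *)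
Lemma cycles9_2_line :
  balanced_count = 6%N -> cycles R s 2 = <[fan_cycle]>%VS.
Proof.
move=> /fan_cycle_cycle Fc; apply/eqP; rewrite eqEsubv -memvE Fc andbT.
apply/subvP => z zc; apply/vlineP; exists (coef (triangle9 (v0, v1, v3)) z).
apply/eqP; rewrite -subr_eq0; apply/eqP.
apply: (@cycle9_eq0 _ (v0, v1, v3)) => //; first by rewrite memvB // memvZ.
by rewrite linearB linearZ /= coef_fan_cycle /GRing.scale /= mulr1 subrr.
Qed.

Lemma dim_cycles9_2 : \dim (cycles R s 2) = (balanced_count == 6)%N.
Proof.
case: eqP => [/cycles9_2_line->|N].
  rewrite dim_vline; case: eqP => // F0.
  by have := coef_fan_cycle; rewrite F0 linear0 => /eqP; rewrite eq_sym oner_eq0.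
(* An unbalanced triangle has coefficient 0 in every chain of [Omega] in degree 2, so [cycle9_eq0]
   leaves no nonzero 2-cycle. *)
have /allPn[T TT NT] : ~~ all balanced_triangle triangles.
  by rewrite all_count; apply/eqP.
apply/eqP; rewrite dimv_eq0 -subv0; apply/subvP => z zc; rewrite memv0; apply/eqP.
apply: (cycle9_eq0 zc TT); apply: Omega9_2_coef.
  by move: zc; rewrite memv_cap => /andP[].
case: T TT NT => [[x y] k]; rewrite mem_triangles => /and3P[xy yk xk].
by rewrite /triangle9 transitive_triangleE.
Qed.

(** * Betti numbers in terms of the number of balanced triangles *)

Lemma homology9_eq0 p : homology R s p.+3 = 0%VS.
Proof.
rewrite /homology (_ : cycles R s p.+3 = 0%VS) ?limg0 //.
by rewrite /cycles Omega9_eq0 cap0v.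
Qed.

Lemma dim_homology9_0 : \dim (homology R s 0) = (balanced_count == 6)%N.
Proof.
have : (\dim (homology R s 0) + \dim (boundaries R s 0) = 5)%N.
  rewrite -[RHS](card_ord 5) -(dim_allowed0 R s).
  exact: dim_qproj (boundaries_sub_cycles0 R s).
move=> H0; apply: (@addnI (\dim (boundaries R s 0))).
by rewrite dim_boundaries9_0 addnC.
Qed.

Lemma dim_homology9_2 : \dim (homology R s 2) = (balanced_count == 6)%N.
Proof.
have E : boundaries R s 2 = 0%VS by rewrite /boundaries Omega9_eq0 limg0.
rewrite -dim_cycles9_2.
have : (\dim (homology R s 2) + \dim (boundaries R s 2) = \dim (cycles R s 2))%N.
  by apply: dim_qproj; rewrite E sub0v.
have -> : \dim (boundaries R s 2) = 0%N by rewrite E dimv0.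
by rewrite addn0.
Qed.

(** Rank-nullity in degrees 1 and 2. The balanced case counts twice: it lowers the rank of the
    incidence map by one, and it lowers that of the boundary from degree 2 by one. The additive form
    avoids truncated subtraction. *)
Lemma dim_homology9_1 :
  (\dim (homology R s 1) + balanced_count = 4 + (balanced_count == 6).*2)%N.
Proof.
have E2 : (\dim (homology R s 1) + \dim (boundaries R s 1) = \dim (cycles R s 1))%N.
  exact: dim_qproj (boundaries_sub_cycles1 R s no_2cycle9 uniq_mid9).
have := dim_cycles_boundaries R s 0; rewrite Omega1E dim_allowed1 card_arrow9.
have := dim_cycles_boundaries R s 1; rewrite dim_Omega9_2 dim_cycles9_2.
have := dim_boundaries9_0; move: E2.
lia.
Qed.

Lemma betti3_count : betti3 R s =
  if (balanced_count == 6)%N then (1, 0, 1)%N else (0, 4 - balanced_count, 0)%N.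
Proof.
rewrite /betti3 /betti dim_homology9_0 dim_homology9_2.
have := dim_homology9_1; case: eqP => [c6|_] E; congr (_, _, _).
  by apply: (@addIn 6%N); rewrite -[in LHS]c6.
by rewrite -(addn0 4%N) -E addnK.
Qed.

End Signing.

(** * Counting the 512 signings *)

(** Turns a cardinality over signings into a count along an explicit list of bit sequences, which
    can be computed. *)
Lemma card_preim_enum (T : finType) (U : eqType) (f : T -> U) (L : seq U)
    (Q : pred U) :
    injective f -> uniq L -> (forall x, f x \in L) ->
    {in L, forall u, exists x, f x = u} ->
  #|[set x | Q (f x)]| = count Q L.
Proof.
move=> fI uL fL Lf; rewrite cardE -(size_map f) -size_filter; apply: perm_size.
apply: uniq_perm; rewrite ?map_inj_uniq ?enum_uniq ?filter_uniq // => u.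
rewrite mem_filter; apply/mapP/andP => [[x + ->]|[Qu /Lf[x fx]]].
  by rewrite mem_enum inE.
by exists x; rewrite // mem_enum inE fx.
Qed.

Fixpoint bitseqs (n : nat) : seq bitseq :=
  if n is n'.+1 then map (cons false) (bitseqs n') ++ map (cons true) (bitseqs n')
  else [:: [::]].

Lemma mem_bitseqs n l : (l \in bitseqs n) = (size l == n).
Proof.
elim: n l => [|n IH] [|b l] //; rewrite mem_cat.
  by apply/orP => -[] /mapP[].
apply/orP/idP => [[] /mapP[l' + [_ ->]]|]; rewrite ?IH // => sl.
by case: b sl => sl; [right|left]; apply: map_f; rewrite IH.
Qed.

Definition signs (s : signing D9) : bitseq := [seq sign s e.1 e.2 | e <- edges].

Lemma signs_inj : injective signs.
Proof.
move=> s s' /eq_in_map E; apply/ffunP => a; rewrite -!signE.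
by apply: E; have := valP a; rewrite -mem_edges -surjective_pairing.
Qed.

Lemma signs_surj l : size l = 9%N -> exists s, signs s = l.
Proof.
move=> sl; exists [ffun a => nth false l (index (val a) edges)].
have E x y : arc x y ->
    sign [ffun a : arrow D9 => nth false l (index (val a) edges)] x y =
    nth false l (index (x, y) edges).
  move=> xy; have := signE [ffun a : arrow D9 => nth false l (index (val a) edges)]
    (Sub (x, y) xy).
  by rewrite ffunE SubK.
rewrite /signs /= !E //.
by move: sl {E}; do 9![case: l => // ? l]; case: l.
Qed.

(* The bits are listed as in edges; the sum is written in the shape to which  *)
(* balanced_count unfolds.                                                    *)
Definition bits_count (l : bitseq) : nat :=
  if l is [:: s01; s12; s20; s03; s13; s23; s04; s14; s24] then
    ((s03 == s01 (+) s13) + ((s13 == s12 (+) s23) + ((s23 == s20 (+) s03) +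
    ((s04 == s01 (+) s14) + ((s14 == s12 (+) s24) + ((s24 == s20 (+) s04) + 0))))))%N
  else 0%N.

Lemma balanced_count_signs s : balanced_count s = bits_count (signs s).
Proof. by []. Qed.

Lemma card_balanced_count n :
  #|[set s | balanced_count s == n]| = count (fun l => bits_count l == n) (bitseqs 9).
Proof.
apply: (card_preim_enum (fun l => bits_count l == n) signs_inj).
- by vm_compute.
- by move=> s; rewrite mem_bitseqs size_map.
by move=> l; rewrite mem_bitseqs => /eqP/signs_surj.
Qed.

Lemma sign_neg_on N (x y : D9) : arc x y ->
  sign (neg_on N) x y = ((nat_of_ord x, nat_of_ord y) \in N).
Proof.
by move=> xy; have := signE (neg_on N) (Sub (x, y) xy); rewrite ffunE SubK.
Qed.

Local Open Scope nat_scope.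

Theorem mainTheorem7 (R : realType) :
  #|signing D9| = 2 ^ 9 /\
  (forall s : signing D9,
     betti3 R s \in [:: (1, 0, 1); (0, 0, 0); (0, 2, 0); (0, 4, 0)]) /\
  (#|[set s : signing D9 | betti3 R s == (1, 0, 1)]| = 16 /\
   betti3 R (neg_on [::]) = (1, 0, 1)) /\
  (#|[set s : signing D9 | betti3 R s == (0, 0, 0)]| = 240 /\
   betti3 R (neg_on [:: (2, 4)]) = (0, 0, 0)) /\
  (#|[set s : signing D9 | betti3 R s == (0, 2, 0)]| = 240 /\
   betti3 R (neg_on [:: (2, 3); (2, 4)]) = (0, 2, 0)) /\
  (#|[set s : signing D9 | betti3 R s == (0, 4, 0)]| = 16 /\
   betti3 R (neg_on [:: (2, 0); (1, 3); (1, 4)]) = (0, 4, 0)) /\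
  (forall (s : signing D9) (p : nat), 3 <= p -> homology R s p = 0%VS) /\
  (forall s : signing D9,
     (\dim (homology R s 2) = 1 <-> switching_balanced s) /\
     (~ switching_balanced s -> homology R s 2 = 0%VS)).
Proof.
have betti_card c n : (forall s : signing D9,
    (betti3 R s == c) = (balanced_count s == n)) ->
  #|[set s : signing D9 | betti3 R s == c]| =
    count (fun l => bits_count l == n) (bitseqs 9).
  move=> E; rewrite -card_balanced_count; apply: eq_card => s.
  by rewrite !inE E.
(* The counts 6, 4, 2, 0 give four distinct Betti vectors, so each vector determines the count and
   the census of Betti vectors becomes one of counts. *)
have bettiE (s : signing D9) c n : (c, n) \in
      [:: ((1, 0, 1), 6); ((0, 0, 0), 4); ((0, 2, 0), 2); ((0, 4, 0), 0)] ->
    (betti3 R s == c) = (balanced_count s == n).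
  rewrite !inE betti3_count; case: (balanced_countE s) => ->;
    by do ![case/predU1P => [[-> ->]|]]; [..|case/eqP=> -> ->].
have count_neg_on N : balanced_count (neg_on N) = bits_count
    [seq (nat_of_ord e.1, nat_of_ord e.2) \in N | e <- edges].
  rewrite balanced_count_signs; congr bits_count; apply/eq_in_map => -[x y].
  by rewrite mem_edges; exact: sign_neg_on.
split; first by rewrite card_ffun card_bool card_arrow9.
split.
  by move=> s; rewrite betti3_count; case: (balanced_countE s) => ->.
split.
  split; last by rewrite betti3_count count_neg_on.
  by rewrite (betti_card _ 6) => [|s]; [vm_compute | exact: bettiE].
split.
  split; last by rewrite betti3_count count_neg_on.
  by rewrite (betti_card _ 4) => [|s]; [vm_compute | exact: bettiE].
split.
  split; last by rewrite betti3_count count_neg_on.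
  by rewrite (betti_card _ 2) => [|s]; [vm_compute | exact: bettiE].
split.
  split; last by rewrite betti3_count count_neg_on.
  by rewrite (betti_card _ 0) => [|s]; [vm_compute | exact: bettiE].
split; first by move=> s [|[|[|p]]] // _; exact: homology9_eq0.
move=> s; split.
  rewrite dim_homology9_2; split => [|/switching_balanced_count-> //].
  by case: eqP => // bal _; apply/switching_balanced_count.
move=> Nbal; apply/eqP; rewrite -dimv_eq0 dim_homology9_2.
by case: (balanced_count s =P 6) => // /switching_balanced_count.
Qed.
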